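(* For each active link $(i,j)$, the alternating coordinate descent procedure described in the context converges to the unique global minimizer $(l_{ij}^*,t_{ij}^* )$ of the Lagrangian subproblem of minimizing $\Phi_{ij}(l,t)$ over the box $\mathcal{F}_{ij}=[l_{\min},B]\times[t_{\min},T_{\max}^{\mathrm{QoS}}]$.
   Context: Fix a link $(i,j)$ with load $m_{ij}>0$ (an active link), constants $N_0,h_{ij}>0$, $\alpha\in[0,1]$, $0<l_{\min}<B$, $0<t_{\min}<T_{\max}^{\mathrm{QoS}}$, a finite commodity set $\mathcal{K}$, coefficients $\rho_{ij}^k\in[0,1]$ with $\sum_{k}\rho_{ij}^k=1$, and dual multipliers $\omega\ge0$, $\varphi_i\ge0$, $\theta^k\ge0$ with $\sum_{k\in\mathcal{K}}\theta^k=\alpha$. Define $$p_{ij}(l,t)=\frac{N_0l}{h_{ij}}\big(2^{m_{ij}/(lt)}-1\big),\qquad E_{ij}(l,t)=t\,p_{ij}(l,t),$$ $$\Phi_{ij}(l,t)=(1-\alpha)E_{ij}(l,t)+\varphi_i\,p_{ij}(l,t)+\omega\,l+\Big(\sum_{k\in\mathcal{K}}\theta^k\rho_{ij}^k\Big)t .$$ **Procedure.** Starting from $(l^{(0)},t^{(0)})\in\mathcal{F}_{ij}$, for $q=1,2,\dots$: let $l^{(q)}$ be obtained by solving $\partial\Phi_{ij}/\partial l=0$ with $t=t^{(q-1)}$ by exact one-dimensional bisection on $[l_{\min},B]$; then let $t^{(q)}$ be obtained by solving $\partial\Phi_{ij}/\partial t=0$ with $l=l^{(q)}$ by exact one-dimensional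 bisection on $[t_{\min},T_{\max}^{\mathrm{QoS}}]$. That is, each update is the exact minimization of $\Phi_{ij}$ in one coordinate over its interval. The procedure is considered as generating an infinite sequence $(l^{(q)},t^{(q)})$.
   Formalization: Adds the assumption that α<1, or φ_i>0, or both ω>0 and Σ_k θ^k ρ_ij^k>0; otherwise Φ_ij = ω l + (Σ_k θ^k ρ_ij^k) t with a zero coefficient, and the minimizer over the box is not unique. *)

(* Defs.v *)
From mathcomp Require Import all_boot all_order all_algebra.
From mathcomp Require Import all_classical all_reals all_analysis.
Set Implicit Arguments.
Unset Strict Implicit.
Unset Printing Implicit Defensive.
Import Order.TTheory GRing.Theory Num.Theory.
Import numFieldNormedType.Exports.
Local Open Scope classical_set_scope.
Local Open Scope ring_scope.

Section LinkSubproblem.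
Variables (R : realType) (K : finType).
Implicit Types (l t : R).

(* All link-indexed quantities are those of one fixed link (i, j): h is h_ij,
   m is m_ij, phi is phi_i, and rho k is rho_ij^k. *)

Definition link_power (N0 h m : R) l t : R :=
  N0 * l / h * (2 `^ (m / (l * t)) - 1).

Definition link_energy (N0 h m : R) l t : R := t * link_power N0 h m l t.

Definition delay_weight (theta rho : K -> R) : R := \sum_k theta k * rho k.

Definition link_Phi (N0 h m alpha phi omega : R) (theta rho : K -> R) l t : R :=
  (1 - alpha) * link_energy N0 h m l t + phi * link_power N0 h m l t + omega * l
  + delay_weight theta rho * t.

(* When this fails, alpha = 1, phi = 0 and link_Phi l t = omega * l + w * t with
   omega = 0 or w = 0, so it is constant along an edge of the box on which it
   is minimal, and its minimizer is not unique. *)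
Definition nondegenerate_link (alpha phi omega : R) (theta rho : K -> R) : Prop :=
  alpha < 1 \/ 0 < phi \/ (0 < omega /\ 0 < delay_weight theta rho).

End LinkSubproblem.

Section Minimization.
Variable R : realType.

Definition is_minimizer (T : Type) (A : set T) (f : T -> R) (x : T) : Prop :=
  A x /\ forall y, A y -> f x <= f y.

(* The one-dimensional updates are exact minimizations over the interval, so
   an endpoint is returned when the partial derivative has no zero there. *)
Definition alternating_descent (I J : set R) (F : R -> R -> R)
    (l t : nat -> R) : Prop :=
  [/\ I (l 0%N), J (t 0%N) &
      forall q : nat,
        is_minimizer I (fun x => F x (t q)) (l q.+1) /\
        is_minimizer J (fun y => F (l q.+1) y) (t q.+1)].

End Minimization.

(* Main.v *)
Require Import Defs.
From HB Require Import structures.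
From mathcomp Require Import all_boot all_order all_algebra.
From mathcomp Require Import all_classical all_reals all_analysis.
From mathcomp Require Import ring lra.
Set Implicit Arguments.
Unset Strict Implicit.
Unset Printing Implicit Defensive.
Import Order.TTheory GRing.Theory Num.Theory.
Import numFieldNormedType.Exports.
Local Open Scope classical_set_scope.
Local Open Scope ring_scope.

(** Put v = m ln 2 / (l t) and X(v) = (e^v - 1) / v.  Then the power is a
    constant times X(v) / t and the energy is a constant times X(v), so the
    objective is a nonnegative combination of X(v), X(v) / t, l and t.  Each of
    these four terms is the exponential of a convex function of (ln l, ln t),
    in which ln v is affine: the only nontrivial point is that ln X is convex in
    ln v, because its derivative v / (1 - e^-v) - 1 with respect to ln v
    increases ([exp_elast_lt]).  Convexity is used in the form of tangent
    inequalities, with the logarithmic partial derivatives A = l dF/dl and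
    B = t dF/dt as slopes; it gives [link_Phi_slopes]: a point of the box at
    which A and B point uphill towards another point has a strictly smaller
    value than that point.

    Since A and B point uphill towards the whole box at a point that is optimal
    in each coordinate separately, such a point is automatically the strict
    global minimizer ([coordinatewise_minimizer_strict]).  Hence the minimizer
    provided by compactness is unique, and it suffices to see that the iterates
    converge: by continuity their limit is optimal in each coordinate.

    Convergence comes from monotonicity rather than from a descent estimate.
    The slope A increases with t and B increases with l, so that a larger t
    calls for a smaller optimal l and conversely ([minimizer_antitone]).  Two
    consecutive updates thus preserve the order of two successive values of t:
    the sequence t is monotone from the start, and l is monotone, in the
    opposite direction, from index 1 on. *)

(** * Minimizers on an interval *)

Section OneVariable.
Variable R : realType.
Implicit Types (f g : R -> R) (a b x : R).

(** The only trace of convexity that is kept: f increases strictly in any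
    direction along which g points uphill.  Since g matters only through its
    sign, the tangent inequality may be established in any increasing
    reparametrization of the variable, here the logarithm. *)
Definition slope_on (I : set R) f g : Prop :=
  forall x0 x, I x0 -> I x -> x != x0 -> 0 <= g x0 * (x - x0) -> f x0 < f x.

(** If g pointed downhill at the minimizer x0 towards x, by continuity it would
    do so at some x1 strictly between them; seen from x1 it points uphill
    towards x0, so that f x1 < f x0. *)
Lemma slope_at_minimizer a b f g x0 :
  slope_on `[a, b] f g ->
  (forall x, x \in `[a, b] -> {for x, continuous g}) ->
  is_minimizer `[a, b] f x0 ->
  forall x, x \in `[a, b] -> 0 <= g x0 * (x - x0).
Proof.
move=> slope gcont [abx0 minx0] x abx; rewrite leNgt; apply/negP => neg.
pose k (e : R) := g (x0 + e * (x - x0)) * (x - x0).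
have k_cvg : k e @[e --> (0 : R)^'+] --> g x0 * (x - x0).
  apply: cvgMr_tmp; apply: cvg_at_right_filter.
  apply: (@continuous_cvg _ _ _ _ _ (fun e => x0 + e * (x - x0)) g x0).
    exact: (gcont _ abx0).
  have : x0 + e * (x - x0) @[e --> (0 : R)] --> x0 + 0 * (x - x0).
    by apply: cvgD; [exact: cvg_cst | apply: cvgMr_tmp; exact: cvg_id].
  by rewrite mul0r addr0.
have [e [k_lt0 e_gt0 e_lt1]] : exists e, [/\ k e < 0, 0 < e & e < 1].
  apply: (@filter_ex _ (0 : R)^'+).
  near=> e; split; near: e.
  - exact: (cvgr_lt (g x0 * (x - x0))).
  - exact: nbhs_right_gt.
  - exact: nbhs_right_lt.
have nz : x - x0 != 0 by apply: contraTneq neg => ->; rewrite mulr0 ltxx.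
pose x1 := x0 + e * (x - x0).
have abx1 : x1 \in `[a, b].
  rewrite /= !in_itv /= in abx abx0 *; rewrite /x1.
  by apply/andP; split; nra.
suff: f x1 < f x0 by rewrite ltNge minx0.
apply: slope => //.
  by rewrite eq_sym -subr_eq0 addrAC subrr add0r mulf_neq0 ?(gt_eqF e_gt0).
have -> : x0 - x1 = - e * (x - x0) by rewrite /x1; ring.
by rewrite mulrCA nmulr_rge0 ?oppr_lt0// ltW.
Unshelve. all: by end_near.
Qed.

(** If x1 < x2, then the smaller slope g1 is already nonnegative at x1, hence so
    is g2, and f2 would increase from x1 to its minimizer x2. *)
Lemma minimizer_antitone a b f1 g1 f2 g2 x1 x2 :
  slope_on `[a, b] f1 g1 -> slope_on `[a, b] f2 g2 ->
  (forall x, x \in `[a, b] -> {for x, continuous g1}) ->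
  (forall x, x \in `[a, b] -> g1 x <= g2 x) ->
  is_minimizer `[a, b] f1 x1 -> is_minimizer `[a, b] f2 x2 -> x2 <= x1.
Proof.
move=> slope1 slope2 cont1 le12 min1 [abx2 min2].
have abx1 := min1.1; rewrite leNgt; apply/negP => lt12.
have := slope_at_minimizer slope1 cont1 min1 abx2.
rewrite pmulr_lge0 ?subr_gt0// => g1_ge0.
suff: f2 x1 < f2 x2 by rewrite ltNge min2.
apply: slope2 => //; first by rewrite gt_eqF.
by rewrite pmulr_lge0 ?subr_gt0// (le_trans g1_ge0) ?le12.
Qed.

End OneVariable.

(** * Alternating minimization on a box *)

Section TwoVariables.
Variables (R : realType) (a b c d : R) (F A B : R -> R -> R).
Hypotheses (le_ab : a <= b) (le_cd : c <= d).
Hypothesis slopes : forall x0 y0 x y,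
  x0 \in `[a, b] -> y0 \in `[c, d] -> x \in `[a, b] -> y \in `[c, d] ->
  (x, y) != (x0, y0) ->
  0 <= A x0 y0 * (x - x0) -> 0 <= B x0 y0 * (y - y0) -> F x0 y0 < F x y.
Hypothesis F_cont : forall x y, x \in `[a, b] -> y \in `[c, d] ->
  {for (x, y), continuous (fun z : R * R => F z.1 z.2)}.
Hypothesis A_cont : forall x y, x \in `[a, b] -> y \in `[c, d] ->
  {for x, continuous (A ^~ y)}.
Hypothesis B_cont : forall x y, x \in `[a, b] -> y \in `[c, d] ->
  {for y, continuous (B x)}.
Hypothesis A_mono : forall x y y',
  x \in `[a, b] -> y \in `[c, d] -> y' \in `[c, d] -> y <= y' -> A x y <= A x y'.
Hypothesis B_mono : forall x x' y,
  x \in `[a, b] -> x' \in `[a, b] -> y \in `[c, d] -> x <= x' -> B x y <= B x' y.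

Let slope_x y : y \in `[c, d] -> slope_on `[a, b] (F ^~ y) (A ^~ y).
Proof.
move=> cdy x0 x abx0 abx ne pos; apply: slopes => //.
  by apply: contra_neq ne => -[].
by rewrite subrr mulr0.
Qed.

Let slope_y x : x \in `[a, b] -> slope_on `[c, d] (F x) (B x).
Proof.
move=> abx y0 y cdy0 cdy ne pos; apply: slopes => //.
  by apply: contra_neq ne => -[].
by rewrite subrr mulr0.
Qed.

(** Coordinatewise optimality makes both slopes point uphill towards every point
    of the box, and then [slopes] applies in all directions at once.  For a mere
    continuous function this fails; it is the step in which joint
    (pseudo)convexity is essential. *)
Lemma coordinatewise_minimizer_strict x0 y0 :
  is_minimizer `[a, b] (F ^~ y0) x0 -> is_minimizer `[c, d] (F x0) y0 ->
  forall x y, x \in `[a, b] -> y \in `[c, d] ->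
    (x, y) != (x0, y0) -> F x0 y0 < F x y.
Proof.
move=> minx miny x y abx cdy ne; have [abx0 _] := minx; have [cdy0 _] := miny.
apply: slopes => //.
  apply: (slope_at_minimizer (slope_x cdy0) _ minx abx) => x' abx'.
  exact: A_cont.
apply: (slope_at_minimizer (slope_y abx0) _ miny cdy) => y' cdy'.
exact: B_cont.
Qed.

Let argmin_x_antitone x y x' y' : y \in `[c, d] -> y' \in `[c, d] ->
  is_minimizer `[a, b] (F ^~ y) x -> is_minimizer `[a, b] (F ^~ y') x' ->
  y <= y' -> x' <= x.
Proof.
move=> cdy cdy' min1 min2 yy'.
apply: (minimizer_antitone (slope_x cdy) (slope_x cdy') _ _ min1 min2) => u abu.
  exact: A_cont.
exact: A_mono.
Qed.

Let argmin_y_antitone x y x' y' : x \in `[a, b] -> x' \in `[a, b] ->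
  is_minimizer `[c, d] (F x) y -> is_minimizer `[c, d] (F x') y' ->
  x <= x' -> y' <= y.
Proof.
move=> abx abx' min1 min2 xx'.
apply: (minimizer_antitone (slope_y abx) (slope_y abx') _ _ min1 min2) => u cdu.
  exact: B_cont.
exact: B_mono.
Qed.

Let F_lim (u v : nat -> R) x y : x \in `[a, b] -> y \in `[c, d] ->
  u @ \oo --> x -> v @ \oo --> y -> F (u q) (v q) @[q --> \oo] --> F x y.
Proof.
move=> abx cdy ux vy.
by apply: (@continuous2_cvg _ _ _ _ _ _ _ _ F _ _ _ ux vy); exact: F_cont.
Qed.

Let limit_is_minimizer (l t : nat -> R) x y :
  alternating_descent `[a, b] `[c, d] F l t ->
  l @ \oo --> x -> t @ \oo --> y ->
  is_minimizer `[a, b] (F ^~ y) x /\ is_minimizer `[c, d] (F x) y.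
Proof.
move=> [l0 t0 step] lx ty.
have abl q : l q \in `[a, b] by case: q => [//|q]; have [[]] := step q.
have cdt q : t q \in `[c, d] by case: q => [//|q]; have [_ []] := step q.
have abx : x \in `[a, b].
  apply: (@closed_cvg _ _ _ _ l [set` `[a, b]%R] _ _ _ lx).
    exact: interval_closed.
  exact: nearW.
have cdy : y \in `[c, d].
  apply: (@closed_cvg _ _ _ _ t [set` `[c, d]%R] _ _ _ ty).
    exact: interval_closed.
  exact: nearW.
have lSx : l q.+1 @[q --> \oo] --> x by rewrite (cvg_shiftS l).
have tSy : t q.+1 @[q --> \oo] --> y by rewrite (cvg_shiftS t).
split; split=> // z zI.
  have cz : (fun _ : nat => z) @ \oo --> z by exact: cvg_cst.
  have Fx := F_lim abx cdy lSx ty.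
  have Fz := F_lim zI cdy cz ty.
  apply: (ler_cvg_to Fx Fz).
  by apply: nearW => q; have [[_ ->]] := step q.
have cz : (fun _ : nat => z) @ \oo --> z by exact: cvg_cst.
have Fy := F_lim abx cdy lSx tSy.
have Fz := F_lim abx zI lSx cz.
apply: (ler_cvg_to Fy Fz).
by apply: nearW => q; have [_ [_ ->]] := step q.
Qed.

(** Both partial minimizations reverse the order, so the map sending one value
    of t to the next preserves it, and the comparison of the first two values
    propagates.  The starting value of l is arbitrary, which is why l is
    compared from index 1 on only. *)
Lemma alternating_descent_monotone (l t : nat -> R) :
  alternating_descent `[a, b] `[c, d] F l t ->
  (forall q, t q <= t q.+1 /\ l q.+2 <= l q.+1) \/
  (forall q, t q.+1 <= t q /\ l q.+1 <= l q.+2).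
Proof.
move=> [l0 t0 step].
have abl q : l q \in `[a, b] by case: q => [//|q]; have [[]] := step q.
have cdt q : t q \in `[c, d] by case: q => [//|q]; have [_ []] := step q.
have lS p q : t p <= t q -> l q.+1 <= l p.+1.
  by apply: argmin_x_antitone => //; have [] := step p; have [] := step q.
have tS p q : l p.+1 <= l q.+1 -> t q.+1 <= t p.+1.
  by apply: argmin_y_antitone => //; have [] := step p; have [] := step q.
have [le01|/ltW le10] := leP (t 0%N) (t 1%N); [left|right].
- have le q : t q <= t q.+1 by elim: q => [//|q /lS/tS].
  by move=> q; split=> //; apply: lS.
- have le q : t q.+1 <= t q by elim: q => [//|q /lS/tS].
  by move=> q; split=> //; apply: lS.
Qed.

Let box_cvg (e f : R) (u : nat -> R) : (forall q, u q \in `[e, f]) ->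
  (forall q, u q <= u q.+1) \/ (forall q, u q.+1 <= u q) -> cvgn u.
Proof.
move=> efu [] mono.
- apply: nondecreasing_is_cvgn; first exact/nondecreasing_seqP.
  by exists f => _ [q _ <-]; have := efu q; rewrite /= in_itv => /andP[].
- apply: nonincreasing_is_cvgn; first exact/nonincreasing_seqP.
  by exists e => _ [q _ <-]; have := efu q; rewrite /= in_itv => /andP[].
Qed.

(** Compactness supplies a minimizer, and the strictness of coordinatewise
    minimizers gives both its uniqueness and its equality with the limit of the
    monotone iterates. *)
Theorem alternating_descent_cvg : exists x y : R,
  unique (is_minimizer (`[a, b] `*` `[c, d]) (fun z : R * R => F z.1 z.2))
    (x, y) /\
  forall l t : nat -> R, alternating_descent `[a, b] `[c, d] F l t ->
    (fun q => (l q, t q)) @ \oo --> (x, y).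
Proof.
have [[x y]] : exists2 z : R * R, z \in (`[a, b] `*` `[c, d]) &
    forall z', z' \in (`[a, b] `*` `[c, d]) -> F z.1 z.2 <= F z'.1 z'.2.
  apply: (@compact_EVT_min _ _ (fun z : R * R => F z.1 z.2)).
  - by exists (a, c); split; rewrite /= in_itv /= lexx.
  - by apply: compact_setX; exact: segment_compact.
  - apply: continuous_in_subspaceT => -[x y]; rewrite inE => -[/= abx cdy].
    exact: F_cont.
rewrite inE => -[/= abx cdy] minxy; exists x, y.
have strict : forall x' y', x' \in `[a, b] -> y' \in `[c, d] ->
    (x', y') != (x, y) -> F x y < F x' y'.
  apply: coordinatewise_minimizer_strict; split=> // z zI.
    by apply: (minxy (z, y)); rewrite inE.
  by apply: (minxy (x, z)); rewrite inE.
split.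
  split.
    by split=> // z zI; apply: minxy; rewrite inE.
  move=> [x' y'] [[/= abx' cdy'] min']; apply/eqP/negPn/negP => ne.
  have := strict x' y' abx' cdy'; rewrite eq_sym => /(_ ne).
  by rewrite ltNge (min' (x, y)).
move=> l t desc; have [l0 t0 step] := desc.
have abl q : l q \in `[a, b] by case: q => [//|q]; have [[]] := step q.
have cdt q : t q \in `[c, d] by case: q => [//|q]; have [_ []] := step q.
have mono := alternating_descent_monotone desc.
have tcvg : cvgn t.
  by apply: (box_cvg cdt); case: mono => mono; [left|right] => q; case: (mono q).
have lcvg : cvgn l.
  have : cvgn (fun q => l q.+1).
    apply: (box_cvg (fun q => abl q.+1)).
    by case: mono => mono; [right|left] => q; case: (mono q).
  move=> /cvg_ex[v]; rewrite (cvg_shiftS l) => lv.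
  by apply/cvg_ex; exists v.
have [minx miny] := limit_is_minimizer desc lcvg tcvg.
suff -> : (x, y) = (limn l, limn t).
  exact: (cvg_pair (G := nbhs (limn l)) (H := nbhs (limn t))).
apply/eqP/negPn/negP => ne.
have := coordinatewise_minimizer_strict minx miny abx cdy ne.
by rewrite ltNge (minxy (limn l, limn t))// inE; split; [case: minx|case: miny].
Qed.

End TwoVariables.

(** * Convexity of ln ((e^v - 1) / v) as a function of ln v *)

Section ExponentialQuotient.
Variable R : realType.
Implicit Types (u v : R).

Definition exp_quot v : R := (expR v - 1) / v.

(** The derivative of ln (e^v - 1) with respect to ln v; that of ln (exp_quot v)
    is one less. *)
Definition exp_elast v : R := v / (1 - expR (- v)).

Lemma expm1_gt0 v : 0 < v -> 0 < expR v - 1.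
Proof. by move=> v0; rewrite subr_gt0 expR_gt1. Qed.

Lemma subr1_expRN_gt0 v : 0 < v -> 0 < 1 - expR (- v).
Proof. by move=> v0; rewrite subr_gt0 expR_lt1 oppr_lt0. Qed.

Lemma exp_quot_gt0 v : 0 < v -> 0 < exp_quot v.
Proof. by move=> v0; rewrite divr_gt0 ?expm1_gt0. Qed.

Lemma exp_elast_gt1 v : 0 < v -> 1 < exp_elast v.
Proof.
move=> v0; rewrite /exp_elast ltr_pdivlMr ?subr1_expRN_gt0// mul1r ltrBlDr -ltrBlDl.
by apply: expR_gt1Dx; rewrite oppr_eq0 gt_eqF.
Qed.

(** The reciprocal (1 - e^-v) / v is the slope of a chord from 0 of the strictly
    concave function 1 - e^-v, hence it decreases. *)
Lemma exp_elast_lt u v : 0 < u -> u < v -> exp_elast u < exp_elast v.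
Proof.
move=> u0 uv; have v0 := lt_trans u0 uv.
rewrite /exp_elast ltr_pdivrMr ?subr1_expRN_gt0// mulrAC ltr_pdivlMr ?subr1_expRN_gt0//.
(* Tangent bounds for the exponential: e1 at - u, and e2 at 0. *)
have e1 : expR (- v) > expR (- u) * (1 - (v - u)).
  have -> : - v = - u + - (v - u) by ring.
  by rewrite expRD ltr_pM2l ?expR_gt0// expR_gt1Dx// oppr_eq0 subr_eq0 gt_eqF.
have e2 : expR (- u) * (1 + u) < 1.
  by rewrite -[ltRHS](expRxMexpNx_1 u) mulrC ltr_pM2r ?expR_gt0// expR_gt1Dx// gt_eqF.
by nra.
Qed.

Lemma is_derive_log_expm1 (k v : R) : 0 < v ->
  is_derive v 1 (fun x => ln (expR x - 1) - k * ln x)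
    ((exp_elast v - k) / v).
Proof.
move=> v0.
have d1 : is_derive v 1 (fun x => ln (expR x - 1)) ((expR v - 1)^-1 * expR v).
  apply: (@is_derive1_comp _ _ (fun x => expR x - 1)).
    by apply: is_derive1_ln; exact: expm1_gt0.
  rewrite -[X in is_derive _ _ _ X]subr0.
  by apply: is_deriveB.
have d2 : is_derive v 1 (fun x => k * ln x) (k * v^-1).
  by apply: is_deriveZ; exact: is_derive1_ln.
have := is_deriveB d1 d2.
congr (is_derive _ _ _ _).
rewrite /exp_elast expRN; have e1 := expm1_gt0 v0.
by field; rewrite ?gt_eqF ?expR_gt0.
Qed.

(** The tangent inequality of v |-> ln (exp_quot v) in the variable ln v, by the
    mean value theorem: the derivative of ln (e^x - 1) - (exp_elast u) ln x
    has the sign of exp_elast x - exp_elast u, so that this function has a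
    strict minimum at u. *)
Lemma exp_quot_log_tangent u v : 0 < u -> 0 < v -> v != u ->
  (exp_elast u - 1) * (ln v - ln u) < ln (exp_quot v) - ln (exp_quot u).
Proof.
move=> u0 v0 ne.
pose D x := ln (expR x - 1) - exp_elast u * ln x.
have dD (x : R) : 0 < x -> is_derive x 1 D ((exp_elast x - exp_elast u) / x).
  exact: is_derive_log_expm1.
have contD (x y : R) : 0 < x -> {within `[x, y], continuous D}.
  move=> x0; apply: derivable_within_continuous => z.
  by rewrite in_itv => /andP[xz _]; have [] := dD z (lt_le_trans x0 xz).
suff lt_D : D u < D v.
  rewrite /exp_quot !ln_div ?posrE ?expm1_gt0//; move: lt_D; rewrite /D.
  by nra.
have [uv|vu|E] := ltgtP u v; last by rewrite E eqxx in ne.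
- have [x|x] := MVT uv (df := fun x => (exp_elast x - exp_elast u) / x) _ (contD _ _ u0).
    by rewrite in_itv => /andP[ux _]; exact: dD (lt_trans u0 ux).
  rewrite in_itv => /andP[/= ux _] E; rewrite -subr_gt0 E.
  by rewrite mulr_gt0 ?divr_gt0 ?subr_gt0 ?exp_elast_lt// (lt_trans u0).
- have [x|x] := MVT vu (df := fun x => (exp_elast x - exp_elast u) / x) _ (contD _ _ v0).
    by rewrite in_itv => /andP[ux _]; exact: dD (lt_trans v0 ux).
  rewrite in_itv => /andP[/= vx xu] E; have x0 := lt_trans v0 vx.
  rewrite -subr_lt0 E nmulr_rlt0 ?subr_gt0//.
  by rewrite pmulr_llt0 ?invr_gt0// subr_lt0 exp_elast_lt.
Qed.

Lemma exp_quot_le u v : 0 < u -> u <= v -> exp_quot u <= exp_quot v.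
Proof.
move=> u0; rewrite le_eqVlt => /predU1P[->//|uv].
have v0 := lt_trans u0 uv.
have := exp_quot_log_tangent u0 v0; rewrite gt_eqF// => /(_ isT).
move=> h; rewrite -ler_ln ?posrE ?exp_quot_gt0// -subr_ge0.
apply/ltW/(lt_trans _ h); rewrite mulr_gt0 ?subr_gt0 ?exp_elast_gt1//.
by rewrite ltr_ln.
Qed.

Lemma exp_elast_le u v : 0 < u -> u <= v -> exp_elast u <= exp_elast v.
Proof.
by move=> u0; rewrite le_eqVlt => /predU1P[->//|/(exp_elast_lt u0)/ltW].
Qed.

Lemma continuous_exp_quot v : 0 < v -> {for v, continuous exp_quot}.
Proof.
move=> v0; apply: cvgM.
  by apply: cvgB; [exact: continuous_expR | exact: cvg_cst].
by apply: cvgV; [rewrite gt_eqF | exact: cvg_id].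
Qed.

Lemma continuous_exp_elast v : 0 < v -> {for v, continuous exp_elast}.
Proof.
move=> v0; apply: cvgM; first exact: cvg_id.
apply: cvgV; first by rewrite gt_eqF ?subr1_expRN_gt0.
apply: cvgB; first exact: cvg_cst.
apply: (@continuous_comp _ _ _ -%R expR); first exact: opp_continuous.
exact: continuous_expR.
Qed.

(** Convexity of the exponential, 1 + z <= e^z at z = ln x - ln x0.  It turns
    a tangent inequality for the logarithm of a positive function into one for
    the function itself. *)
Lemma ln_tangent (x x0 : R) : 0 < x -> 0 < x0 ->
  x0 * (1 + (ln x - ln x0)) <= x ?= iff (x == x0).
Proof.
move=> x_gt0 x0_gt0; rewrite -{2 3}(lnK x_gt0) -{1 3}(lnK x0_gt0).
set a := ln x; set b := ln x0.
have -> : expR a = expR b * expR (a - b) by rewrite -expRD addrC subrK.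
apply/leifP; have [E|ne] := eqVneq a b.
  by rewrite E subrr expR0 addr0 mulr1 eqxx.
case: ifPn => [/eqP h|_].
  have := expR_gt1Dx (x := a - b).
  rewrite subr_eq0 => /(_ ne).
  have: expR (a - b) = 1.
    by apply: (mulfI (lt0r_neq0 (expR_gt0 b))); rewrite h mulr1.
  by rewrite -[RHS]expR0 => /expR_inj/eqP; rewrite subr_eq0 (negbTE ne).
by rewrite ltr_pM2l ?expR_gt0// expR_gt1Dx// subr_eq0.
Qed.

Lemma exp_quot_tangent u v : 0 < u -> 0 < v ->
  exp_quot u * (1 + (exp_elast u - 1) * (ln v - ln u)) <= exp_quot v
    ?= iff (v == u).
Proof.
move=> u0 v0; apply/leifP; have [->|ne] := eqVneq v u.
  by rewrite subrr mulr0 addr0 mulr1.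
apply: lt_le_trans (ln_tangent (exp_quot_gt0 v0) (exp_quot_gt0 u0)).1.
by rewrite ltr_pM2l ?exp_quot_gt0// ltrD2l exp_quot_log_tangent.
Qed.

(** When v = u, the logarithm of the right-hand side is affine in ln t and
    strictness comes from the exponential alone.  Since v depends on (l, t)
    through the product l t only, this is what excludes ties along the curves
    where l t is constant as soon as the power has a positive weight. *)
Lemma exp_quot_div_tangent u v s t : 0 < u -> 0 < v -> 0 < s -> 0 < t ->
  exp_quot u / s * (1 + ((exp_elast u - 1) * (ln v - ln u) - (ln t - ln s)))
    <= exp_quot v / t ?= iff ((v == u) && (t == s)).
Proof.
move=> u0 v0 s0 t0; have [qu qv] := (exp_quot_gt0 u0, exp_quot_gt0 v0).
have tangent := ln_tangent (divr_gt0 qv t0) (divr_gt0 qu s0).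
have ln_quot (x y : R) : 0 < x -> 0 < y ->
    ln (exp_quot x / y) = ln (exp_quot x) - ln y.
  by move=> x0 y0; apply: ln_div; rewrite posrE ?exp_quot_gt0.
rewrite !ln_quot// in tangent.
apply/leifP; have [E|ne] := eqVneq v u.
  have [->|ne] := eqVneq t s; first by rewrite E !subrr mulr0 subrr addr0 mulr1 /= eqxx.
  have : exp_quot u / t != exp_quot u / s.
    by apply: contra_neq ne => /(mulfI (lt0r_neq0 qu))/invr_inj.
  rewrite -{1}E -(lt_leif tangent) E.
  apply: le_lt_trans; rewrite (ler_pM2l (divr_gt0 qu s0)); lra.
apply: lt_le_trans tangent.1.
rewrite (ltr_pM2l (divr_gt0 qu s0)) ltrD2l.
by have := exp_quot_log_tangent u0 v0 ne; lra.
Qed.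

End ExponentialQuotient.

(** * The objective of a link *)

Section LinkFunction.
Variables (R : realType) (K : finType).
Variables (N0 h m alpha phi omega : R) (theta rho : K -> R).
Hypotheses (N0_gt0 : 0 < N0) (h_gt0 : 0 < h) (m_gt0 : 0 < m).
Hypotheses (alpha_le1 : alpha <= 1) (phi_ge0 : 0 <= phi).
Hypotheses (omega_ge0 : 0 <= omega).
Implicit Types l t : R.

Let w := delay_weight theta rho.
Hypothesis w_ge0 : 0 <= w.

Definition load_exponent l t : R := m * ln 2 / (l * t).
Let c : R := N0 / h * (m * ln 2).
Let v := load_exponent.

Let mln2_gt0 : 0 < m * ln 2.
Proof. by rewrite mulr_gt0// ln_gt0// ltr1n. Qed.

Let c_gt0 : 0 < c.
Proof. by rewrite /c mulr_gt0// divr_gt0. Qed.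

Lemma load_exponent_gt0 l t : 0 < l -> 0 < t -> 0 < v l t.
Proof. by move=> l0 t0; rewrite /v divr_gt0// mulr_gt0. Qed.

Lemma load_exponent_le l l' t t' : 0 < l -> 0 < t -> l <= l' -> t <= t' ->
  v l' t' <= v l t.
Proof.
move=> l0 t0 ll' tt'; have l'0 := lt_le_trans l0 ll'.
have t'0 := lt_le_trans t0 tt'.
rewrite /v /load_exponent ler_pM2l// lef_pV2 ?posrE ?mulr_gt0//.
by rewrite ler_pM// ltW.
Qed.

Lemma ln_load_exponent l t : 0 < l -> 0 < t ->
  ln (v l t) = ln (m * ln 2) - ln l - ln t.
Proof.
move=> l0 t0; rewrite /v /load_exponent ln_div ?posrE ?mln2_gt0 ?mulr_gt0//.
by rewrite [ln (l * t)]lnM// opprD addrA.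
Qed.

Lemma link_powerE l t : 0 < l -> 0 < t ->
  link_power N0 h m l t = c * exp_quot (v l t) / t.
Proof.
move=> l0 t0; have v0 := load_exponent_gt0 l0 t0.
rewrite /link_power /powR pnatr_eq0/= /exp_quot.
have -> : m / (l * t) * ln 2 = v l t by rewrite /v /load_exponent mulrAC.
rewrite /c /v /load_exponent; set e := expR _.
by field; rewrite !gt_eqF ?ln_gt0 ?ltr1n.
Qed.

Let F := link_Phi N0 h m alpha phi omega theta rho.

Lemma link_PhiE l t : 0 < l -> 0 < t ->
  F l t = (1 - alpha) * c * exp_quot (v l t)
          + phi * c * (exp_quot (v l t) / t) + omega * l + w * t.
Proof.
move=> l0 t0; rewrite /F /link_Phi /link_energy link_powerE// -/w.
by field; rewrite gt_eqF.
Qed.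

(** The logarithmic partial derivatives l dF/dl and t dF/dt of the objective,
    written so that their monotonicity in the other variable can be read off:
    each factor subtracted is nonnegative and nonincreasing in that variable. *)
Definition link_slope_l l t : R := omega * l -
  c * exp_quot (v l t) * (1 - alpha + phi / t) * (exp_elast (v l t) - 1).

Definition link_slope_t l t : R := w * t -
  c * exp_quot (v l t) *
  ((1 - alpha + phi / t) * (exp_elast (v l t) - 1) + phi / t).

Let q_gt0 l t : 0 < l -> 0 < t -> 0 < c * exp_quot (v l t).
Proof. by move=> l0 t0; rewrite mulr_gt0// exp_quot_gt0// load_exponent_gt0. Qed.

Let e_gt0 l t : 0 < l -> 0 < t -> 0 < exp_elast (v l t) - 1.
Proof. by move=> l0 t0; rewrite subr_gt0 exp_elast_gt1// load_exponent_gt0. Qed.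

Let weight_ge0 t : 0 < t -> 0 <= 1 - alpha + phi / t.
Proof. by move=> t0; rewrite addr_ge0 ?subr_ge0// divr_ge0// ltW. Qed.

Let q_le l l' t t' : 0 < l -> 0 < t -> l <= l' -> t <= t' ->
  c * exp_quot (v l' t') <= c * exp_quot (v l t).
Proof.
move=> l0 t0 ll' tt'; rewrite ler_pM2l// exp_quot_le ?load_exponent_le//.
by apply: load_exponent_gt0; [exact: lt_le_trans ll' | exact: lt_le_trans tt'].
Qed.

Let e_le l l' t t' : 0 < l -> 0 < t -> l <= l' -> t <= t' ->
  exp_elast (v l' t') - 1 <= exp_elast (v l t) - 1.
Proof.
move=> l0 t0 ll' tt'; rewrite lerD2r exp_elast_le ?load_exponent_le//.
by apply: load_exponent_gt0; [exact: lt_le_trans ll' | exact: lt_le_trans tt'].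
Qed.

Lemma link_slope_l_mono l t t' : 0 < l -> 0 < t -> t <= t' ->
  link_slope_l l t <= link_slope_l l t'.
Proof.
move=> l0 t0 tt'; have t'0 := lt_le_trans t0 tt'.
rewrite lerD2l lerN2; have ll := lexx l.
have wle : 1 - alpha + phi / t' <= 1 - alpha + phi / t.
  by rewrite lerD2l ler_wpM2l// lef_pV2.
apply: ler_pM (e_le l0 t0 ll tt'); last 2 first.
- exact: ltW (e_gt0 l0 t'0).
- exact: ler_pM (ltW (q_gt0 l0 t'0)) (weight_ge0 t'0) (q_le l0 t0 ll tt') wle.
by rewrite mulr_ge0 ?weight_ge0// ltW ?q_gt0.
Qed.

Lemma link_slope_t_mono l l' t : 0 < l -> 0 < t -> l <= l' ->
  link_slope_t l t <= link_slope_t l' t.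
Proof.
move=> l0 t0 ll'; have l'0 := lt_le_trans l0 ll'; have tt := lexx t.
rewrite lerD2l lerN2; apply: ler_pM (q_le l0 t0 ll' tt) _.
- exact: ltW (q_gt0 l'0 t0).
- rewrite addr_ge0//; last by rewrite divr_ge0// ltW.
  exact: mulr_ge0 (weight_ge0 t0) (ltW (e_gt0 l'0 t0)).
- by rewrite lerD2r ler_wpM2l ?weight_ge0// e_le.
Qed.

Lemma continuous_load_exponent (z : R * R) : 0 < z.1 -> 0 < z.2 ->
  {for z, continuous (fun z : R * R => v z.1 z.2)}.
Proof.
move=> l0 t0; apply: cvgMl_tmp; apply: cvgV; first by rewrite gt_eqF ?mulr_gt0.
by apply: cvgM; [exact: cvg_fst | exact: cvg_snd].
Qed.

Lemma continuous_link_Phi (z : R * R) : 0 < z.1 -> 0 < z.2 ->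
  {for z, continuous (fun z : R * R => F z.1 z.2)}.
Proof.
move=> l0 t0.
have cl : (z'.1 : R) @[z' --> z] --> z.1 by exact: cvg_fst.
have ct : (z'.2 : R) @[z' --> z] --> z.2 by exact: cvg_snd.
have cp : link_power N0 h m z'.1 z'.2 @[z' --> z] --> link_power N0 h m z.1 z.2.
  apply: cvgM; first by apply: cvgMr_tmp; exact: cvgMl_tmp.
  apply: cvgB; last exact: cvg_cst.
  rewrite /powR pnatr_eq0/=.
  apply: (@continuous_cvg _ _ _ _ _ (fun z' : R * R => m / (z'.1 * z'.2) * ln 2) expR).
    exact: continuous_expR.
  apply: cvgMr_tmp; apply: cvgMl_tmp; apply: cvgV; last exact: cvgM.
  by rewrite gt_eqF ?mulr_gt0.
apply: cvgD; last exact: cvgMl_tmp.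
apply: cvgD; last exact: cvgMl_tmp.
apply: cvgD; apply: cvgMl_tmp => //.
exact: cvgM.
Qed.

Let quot_cvg (z : R * R) : 0 < z.1 -> 0 < z.2 ->
  exp_quot (v z'.1 z'.2) @[z' --> z] --> exp_quot (v z.1 z.2).
Proof.
move=> l0 t0; apply: (@continuous_cvg _ _ _ _ _ (fun z' : R * R => v z'.1 z'.2)).
  exact/continuous_exp_quot/load_exponent_gt0.
exact: continuous_load_exponent.
Qed.

Let elast_cvg (z : R * R) : 0 < z.1 -> 0 < z.2 ->
  exp_elast (v z'.1 z'.2) @[z' --> z] --> exp_elast (v z.1 z.2).
Proof.
move=> l0 t0; apply: (@continuous_cvg _ _ _ _ _ (fun z' : R * R => v z'.1 z'.2)).
  exact/continuous_exp_elast/load_exponent_gt0.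
exact: continuous_load_exponent.
Qed.

Lemma continuous_link_slope_l (z : R * R) : 0 < z.1 -> 0 < z.2 ->
  {for z, continuous (fun z : R * R => link_slope_l z.1 z.2)}.
Proof.
move=> l0 t0.
have cl : (z'.1 : R) @[z' --> z] --> z.1 by exact: cvg_fst.
have ct : (z'.2 : R) @[z' --> z] --> z.2 by exact: cvg_snd.
apply: cvgB; first exact: cvgMl_tmp.
apply: cvgM; last by apply: cvgB; [exact: elast_cvg | exact: cvg_cst].
apply: cvgM; first by apply: cvgMl_tmp; exact: quot_cvg.
apply: cvgD; first exact: cvg_cst.
by apply: cvgMl_tmp; apply: cvgV; rewrite ?gt_eqF.
Qed.

Lemma continuous_link_slope_t (z : R * R) : 0 < z.1 -> 0 < z.2 ->
  {for z, continuous (fun z : R * R => link_slope_t z.1 z.2)}.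
Proof.
move=> l0 t0.
have cl : (z'.1 : R) @[z' --> z] --> z.1 by exact: cvg_fst.
have ct : (z'.2 : R) @[z' --> z] --> z.2 by exact: cvg_snd.
have cV : phi / z'.2 @[z' --> z] --> phi / z.2.
  by apply: cvgMl_tmp; apply: cvgV; rewrite ?gt_eqF.
apply: cvgB; first exact: cvgMl_tmp.
apply: cvgM; first by apply: cvgMl_tmp; exact: quot_cvg.
apply: cvgD => //.
apply: cvgM; last by apply: cvgB; [exact: elast_cvg | exact: cvg_cst].
by apply: cvgD => //; exact: cvg_cst.
Qed.

(** The slopes are logarithmic derivatives, while their use in the box refers to
    the variables themselves; the two agree because ln is increasing. *)
Lemma sign_ln (k x x0 : R) : 0 < x -> 0 < x0 ->
  0 <= k * (x - x0) -> 0 <= k * (ln x - ln x0).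
Proof.
move=> x_gt0 x0_gt0; have [lt|gt|->] := ltgtP x x0; last by rewrite !subrr.
- by rewrite !nmulr_lge0// subr_lt0// ltr_ln.
- by rewrite !pmulr_lge0// subr_gt0// ltr_ln.
Qed.

Lemma addr6_gt0 (r1 r2 r3 r4 r5 r6 : R) :
  0 <= r1 -> 0 <= r2 -> 0 <= r3 -> 0 <= r4 -> 0 <= r5 -> 0 <= r6 ->
  [|| 0 < r3, 0 < r4, 0 < r5 | 0 < r6] -> 0 < r1 + r2 + r3 + r4 + r5 + r6.
Proof. by move=> ? ? ? ? ? ? /or4P[] ?; lra. Qed.

(** Summing the four tangent inequalities gives
    F - F0 = A x + D y + (nonnegative gaps), with x and y the increments of ln l
    and ln t.  Some gap with positive weight is strict, except in one situation:
    only the energy term is present and x + y = 0, so that the energy does not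
    change.  There A and D are equal and negative, so that uphill slopes force
    x <= 0 and y <= 0, hence no move at all. *)
Lemma link_Phi_slopes l0 t0 l t :
  nondegenerate_link alpha phi omega theta rho ->
  0 < l0 -> 0 < t0 -> 0 < l -> 0 < t -> (l, t) != (l0, t0) ->
  0 <= link_slope_l l0 t0 * (l - l0) -> 0 <= link_slope_t l0 t0 * (t - t0) ->
  F l0 t0 < F l t.
Proof.
move=> nondeg l0_gt0 t0_gt0 l_gt0 t_gt0 ne.
move=> /(sign_ln l_gt0 l0_gt0) Adx /(sign_ln t_gt0 t0_gt0) Bdy.
have v0_gt0 := load_exponent_gt0 l0_gt0 t0_gt0.
have v_gt0 := load_exponent_gt0 l_gt0 t_gt0.
have q0_gt0 := exp_quot_gt0 v0_gt0; have e0_gt0 := e_gt0 l0_gt0 t0_gt0.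
have dv : ln (v l t) - ln (v l0 t0) = - (ln l - ln l0) - (ln t - ln t0).
  by rewrite !ln_load_exponent//; ring.
have T1 := exp_quot_tangent v0_gt0 v_gt0.
have T2 := exp_quot_div_tangent v0_gt0 v_gt0 t0_gt0 t_gt0.
have T3 := ln_tangent l_gt0 l0_gt0.
have T4 := ln_tangent t_gt0 t0_gt0.
rewrite dv in T1 T2; rewrite !link_PhiE//.
move: Adx Bdy; rewrite /link_slope_l /link_slope_t.
have ldx : (l == l0) = (ln l - ln l0 == 0).
  by rewrite subr_eq0; apply/eqP/eqP => [->//|]; apply: ln_inj.
have tdy : (t == t0) = (ln t - ln t0 == 0).
  by rewrite subr_eq0; apply/eqP/eqP => [->//|]; apply: ln_inj.
have vdv : (v l t == v l0 t0) = (ln l - ln l0 + (ln t - ln t0) == 0).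
  rewrite -oppr_eq0 opprD -dv subr_eq0.
  by apply/eqP/eqP => [->//|]; apply: ln_inj.
have ne' : ~~ ((l == l0) && (t == t0)) by rewrite -xpair_eqE.
rewrite ldx tdy in ne'.
have strict2 : ~~ ((v l t == v l0 t0) && (t == t0)).
  apply: contra ne'; rewrite vdv tdy => /andP[/eqP s0 /eqP y0].
  by rewrite y0 addr0 in s0; rewrite s0 y0 eqxx.
have gap2 := lt_leif T2; rewrite strict2 in gap2.
have gap1 := lt_leif T1; have gap3 := lt_leif T3; have gap4 := lt_leif T4.
have ge1 := T1.1; have ge3 := T3.1; have ge4 := T4.1.
move: gap1 gap2 gap3 gap4 ge1 ge3 ge4 {T1 T2 T3 T4 strict2 dv ne}.
rewrite vdv ldx tdy {vdv ldx tdy}.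
(* What follows is algebra in the increments x, y and the values q0, e0, q. *)
move: (exp_quot (v l0 t0)) (exp_elast (v l0 t0) - 1) (exp_quot (v l t)) q0_gt0 e0_gt0.
move: (ln l - ln l0) (ln t - ln t0) ne' => x y ne' q0 e0 q q0_gt0 e0_gt0.
move=> gap1 gap2 gap3 gap4 ge1 ge3 ge4 Adx Bdy.
set A := (X in 0 <= X * x) in Adx.
set D := (X in 0 <= X * y) in Bdy.
set g1L := (X in X <= q) in ge1 gap1.
set g2L := (X in X < q / t) in gap2.
set g3L := (X in X <= l) in ge3 gap3.
set g4L := (X in X <= t) in ge4 gap4.
have E : (1 - alpha) * c * q + phi * c * (q / t) + omega * l + w * t
    - ((1 - alpha) * c * q0 + phi * c * (q0 / t0) + omega * l0 + w * t0)
  = A * x + D * y + (1 - alpha) * c * (q - g1L) + phi * c * (q / t - g2L)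
    + omega * (l - g3L) + w * (t - g4L).
  by rewrite /A /D /g1L /g2L /g3L /g4L; field; rewrite !gt_eqF.
rewrite -subr_gt0 E.
have a1_ge0 : 0 <= (1 - alpha) * c by rewrite mulr_ge0 ?subr_ge0// ltW.
have a2_ge0 : 0 <= phi * c by rewrite mulr_ge0// ltW.
have p1 : 0 <= (1 - alpha) * c * (q - g1L) by rewrite mulr_ge0// subr_ge0.
have p2 : 0 <= phi * c * (q / t - g2L) by rewrite mulr_ge0// subr_ge0 ltW.
have p3 : 0 <= omega * (l - g3L) by rewrite mulr_ge0// subr_ge0.
have p4 : 0 <= w * (t - g4L) by rewrite mulr_ge0// subr_ge0.
have strict_phi : 0 < phi -> 0 < phi * c * (q / t - g2L).
  by move=> phi_gt0; rewrite mulr_gt0 ?subr_gt0// mulr_gt0.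
have strict_omega : 0 < omega -> x != 0 -> 0 < omega * (l - g3L).
  by move=> omega_gt0 nx; rewrite mulr_gt0// subr_gt0 gap3.
have strict_w : 0 < w -> y != 0 -> 0 < w * (t - g4L).
  by move=> w_gt0 ny; rewrite mulr_gt0// subr_gt0 gap4.
apply: addr6_gt0 => //.
case: nondeg => [alpha_lt1|[phi_gt0|[omega_gt0 w_gt0]]]; first last.
- have [x0|nx] := eqVneq x 0; last by rewrite strict_omega ?orbT.
  by rewrite strict_w ?orbT//; rewrite x0 eqxx in ne'.
- by rewrite strict_phi ?orbT.
have a1_gt0 : 0 < (1 - alpha) * c by rewrite mulr_gt0// subr_gt0.
have [xy0|nxy] := eqVneq (x + y) 0; last first.
  by rewrite mulr_gt0// subr_gt0 gap1.
have yE : y = - x by rewrite -(addKr x y) xy0 addr0.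
have nx : x != 0 by apply: contra ne' => x0; rewrite x0 yE oppr_eq0.
have ny : y != 0 by rewrite yE oppr_eq0.
have [phi_gt0|phi_le0] := ltP 0 phi; first by rewrite strict_phi ?orbT.
have [om_gt0|om_le0] := ltP 0 omega; first by rewrite strict_omega ?orbT.
have [w_gt0|w_le0] := ltP 0 w; first by rewrite strict_w ?orbT.
(* What remains is the exceptional situation: only the energy is present. *)
have phi0 : phi = 0 by apply/le_anti/andP.
have omega0 : omega = 0 by apply/le_anti/andP.
have w0 : w = 0 by apply/le_anti/andP.
have AE : A = - ((1 - alpha) * c * q0 * e0).
  by rewrite /A omega0 phi0; ring.
have DE : D = - ((1 - alpha) * c * q0 * e0).
  by rewrite /D w0 phi0; ring.
have k_gt0 := mulr_gt0 (mulr_gt0 a1_gt0 q0_gt0) e0_gt0.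
rewrite AE mulNr oppr_ge0 pmulr_rle0// in Adx.
rewrite DE mulNr oppr_ge0 pmulr_rle0// in Bdy.
have x0 : x = 0 by apply/le_anti/andP; rewrite -oppr_le0 -yE.
by rewrite x0 eqxx in nx.
Qed.

End LinkFunction.

Theorem lemma5 (R : realType) (K : finType)
    (N0 h m alpha phi omega lmin B tmin Tmax : R) (theta rho : K -> R)
    (N0_gt0 : 0 < N0) (h_gt0 : 0 < h) (m_gt0 : 0 < m)
    (alpha_ge0 : 0 <= alpha) (alpha_le1 : alpha <= 1)
    (lmin_gt0 : 0 < lmin) (lmin_lt_B : lmin < B)
    (tmin_gt0 : 0 < tmin) (tmin_lt_Tmax : tmin < Tmax)
    (rho_ge0 : forall k, 0 <= rho k) (rho_le1 : forall k, rho k <= 1)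
    (rho_sum : \sum_k rho k = 1)
    (omega_ge0 : 0 <= omega) (phi_ge0 : 0 <= phi)
    (theta_ge0 : forall k, 0 <= theta k) (theta_sum : \sum_k theta k = alpha)
    (nondeg : nondegenerate_link alpha phi omega theta rho) :
  let F : R -> R -> R := link_Phi N0 h m alpha phi omega theta rho in
  exists lstar tstar : R,
    unique (is_minimizer (`[lmin, B] `*` `[tmin, Tmax])
              (fun z : R * R => F z.1 z.2)) (lstar, tstar) /\
    forall l t : nat -> R,
      alternating_descent `[lmin, B] `[tmin, Tmax] F l t ->
      (fun q => (l q, t q)) @ \oo --> (lstar, tstar).
Proof.
have w_ge0 : 0 <= delay_weight theta rho.
  by apply: sumr_ge0 => k _; rewrite mulr_ge0.
have posl x : x \in `[lmin, B] -> 0 < x.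
  by rewrite in_itv => /andP[/(lt_le_trans lmin_gt0)].
have post y : y \in `[tmin, Tmax] -> 0 < y.
  by rewrite in_itv => /andP[/(lt_le_trans tmin_gt0)].
apply: (alternating_descent_cvg (A := link_slope_l N0 h m alpha phi omega)
  (B := link_slope_t N0 h m alpha phi theta rho)).
- exact: ltW.
- exact: ltW.
- move=> x0 y0 x y /posl x0_gt0 /post y0_gt0 /posl x_gt0 /post y_gt0.
  exact: link_Phi_slopes.
- by move=> x y /posl x_gt0 /post y_gt0; exact: continuous_link_Phi.
- move=> x y /posl x_gt0 /post y_gt0.
  apply: (@continuous_comp _ _ _ (fun x => (x, y))
    (fun z : R * R => link_slope_l N0 h m alpha phi omega z.1 z.2)).
    by apply: (cvg_pair (G := nbhs x) (H := nbhs y)); [exact: cvg_id | exact: cvg_cst].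
  exact: continuous_link_slope_l.
- move=> x y /posl x_gt0 /post y_gt0.
  apply: (@continuous_comp _ _ _ (fun y => (x, y))
    (fun z : R * R => link_slope_t N0 h m alpha phi theta rho z.1 z.2)).
    by apply: (cvg_pair (G := nbhs x) (H := nbhs y)); [exact: cvg_cst | exact: cvg_id].
  exact: continuous_link_slope_t.
- by move=> x y y' /posl x_gt0 /post y_gt0 _; exact: link_slope_l_mono.
- by move=> x x' y /posl x_gt0 _ /post y_gt0; exact: link_slope_t_mono.
Qed.
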